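(* Let $Q$ be an inverse quantal frame. Every $Q$-sheaf is a complete Hilbert $Q$-module; that is, if $X$ is a $Q$-sheaf, then there is an inner product on the left $Q$-module $\mathcal O(X)$ with respect to which $\mathcal O(X)$ is a complete Hilbert $Q$-module.
   Context: An involutive quantale is a sup-lattice (complete lattice) $Q$ with an associative multiplication preserving arbitrary joins in each variable and a join-preserving involution $a\mapsto a^*$ with $a^{**}=a$, $(ab)^*=b^*a^*$; it is unital if the multiplication has a unit $e$. $1$ denotes a top element. A left $Q$-module (for $Q$ unital) is a sup-lattice $X$ with an associative, unital action $Q\times X\to X$ preserving joins in each variable; homomorphisms preserve joins and the action. Inverse quantal frames: a support on a unital involutive quantale $Q$ is a join-preserving map $\varsigma:Q\to Q$ with $\varsigma(a)\le e$, $\varsigma(a)\le aa^*$ and $a\le\varsigma(a)a$ for all $a$; it is stable if $\varsigma(ab)=\varsigma(a\varsigma(b))$ for all $a,b$. A stable quantal frame is a unital involutive quantale with a stable support whose underlying lattice is a frame. An inverse quantal frame is a stable quantal frame $Q$ with $\bigvee\{s\in Q\mid ss^*\vee s^*s\le e\}=1$. The base locale of $Q$ is $B=\{b\in Q\mid b\le e\}$, a frame which is a unital subquantale of $Q$ with trivial involution and multiplication $bc=b\wedge c$. $Q$-sheaves: for a locale $X$, $\mathcal O(X)$ denotes the corresponding frame. A $Q$-locale is a locale $X$ with a left $Q$-module structure on $\mathcal O(X)$ such that $bx=b1\wedge x$ for all $b\in B$, $x\in\mathcal O(X)$. It is open if there is a (necessarily unique) homomorphism of $B$-modules $\varsigma:\mathcal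 O(X)\to B$ with $\varsigma(x)x=x$ for all $x$. A local section of an open $Q$-locale is an element $s\in\mathcal O(X)$ such that $x=\varsigma(x)s$ for all $x\le s$. A $Q$-sheaf is an open $Q$-locale $X$ such that the join of all the local sections is $1$. Complete Hilbert modules: a pre-Hilbert $Q$-module is a left $Q$-module $X$ with an inner product $\langle-,-\rangle:X\times X\to Q$ satisfying $\langle ax,y\rangle=a\langle x,y\rangle$, $\langle\bigvee_i x_i,y\rangle=\bigvee_i\langle x_i,y\rangle$ and $\langle x,y\rangle=\langle y,x\rangle^*$; it is a Hilbert $Q$-module if moreover $\langle x,-\rangle=\langle y,-\rangle$ implies $x=y$. A Hilbert section is an element $s\in X$ such that $\langle x,s\rangle s\le x$ for all $x\in X$; a Hilbert module $X$ is complete if, for all $x\in X$, $x$ is the join of the elements $\langle x,s\rangle s$ with $s$ ranging over all the Hilbert sections. *)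

(* Defs.v *)
From HB Require Import structures.
From mathcomp Require Import all_boot all_order.
From mathcomp Require Import classical_sets.

Set Implicit Arguments.
Unset Strict Implicit.
Unset Printing Implicit Defensive.

Local Open Scope order_scope.
Local Open Scope group_scope.

(* A sup-lattice automatically has finite meets, a top and a bottom, so it is
   based on tbLatticeType in order to use the library's `&`, `|`, \top, \bot. *)
HB.mixin Record hasBigJoin d T of Order.TBLattice d T := {
  bigjoin : set T -> T;
  bigjoin_isLub : forall A : set T, isLub A (bigjoin A)
}.

#[short(type="supLatticeType")]
HB.structure Definition SupLattice d :=
  { T of Order.TBLattice d T & hasBigJoin d T }.

(* Joins of subsets are the same as joins of families, taking A to be the
   range of the family. *)
Definition preserves_joins d d' (T : supLatticeType d) (U : supLatticeType d')
    (f : T -> U) : Prop :=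
  forall A : set T, f (bigjoin A) = bigjoin (f @` A)%classic.

HB.mixin Record isFrame d T of SupLattice d T := {
  meet_preserves_joins : forall x : T, preserves_joins (Order.meet x)
}.

#[short(type="frameType")]
HB.structure Definition Frame d := { T of SupLattice d T & isFrame d T }.

HB.mixin Record isUnitalQuantale d Q of SupLattice d Q & Monoid Q := {
  mulr_preserves_joins : forall a : Q, preserves_joins (fun b : Q => a * b);
  mull_preserves_joins : forall b : Q, preserves_joins (fun a : Q => a * b)
}.

#[short(type="unitalQuantaleType")]
HB.structure Definition UnitalQuantale d :=
  { Q of SupLattice d Q & Monoid Q & isUnitalQuantale d Q }.

(* The involution is the one of starMonoidType, whose operation is named inv
   (it is not an inverse in general).  Beware that the library displays a * b^*
   as a / b. *)
Notation "a ^*" := (inv a) : group_scope.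

HB.mixin Record isInvolutiveQuantale d Q of UnitalQuantale d Q & StarMonoid Q
    := {
  star_preserves_joins : preserves_joins (fun a : Q => a^*)
}.

#[short(type="unitalInvolutiveQuantaleType")]
HB.structure Definition UnitalInvolutiveQuantale d :=
  { Q of UnitalQuantale d Q & StarMonoid Q & isInvolutiveQuantale d Q }.

HB.mixin Record hasStableSupport d Q of UnitalInvolutiveQuantale d Q := {
  supp : Q -> Q;
  supp_preserves_joins : preserves_joins supp;
  supp_le1 : forall a : Q, supp a <= 1;
  supp_le_mulstar : forall a : Q, supp a <= a * a^*;
  le_supp_mul : forall a : Q, a <= supp a * a;
  supp_stable : forall a b : Q, supp (a * b) = supp (a * supp b)
}.

#[short(type="stableQuantalFrameType")]
HB.structure Definition StableQuantalFrame d :=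
  { Q of UnitalInvolutiveQuantale d Q & Frame d Q & hasStableSupport d Q }.

HB.mixin Record isInverseQuantalFrame d Q of StableQuantalFrame d Q := {
  bigjoin_partial_units :
    bigjoin [set s : Q | (s * s^* `|` s^* * s <= 1)%O]%classic = \top
}.

#[short(type="inverseQuantalFrameType")]
HB.structure Definition InverseQuantalFrame d :=
  { Q of StableQuantalFrame d Q & isInverseQuantalFrame d Q }.

HB.mixin Record isLeftModule dQ (Q : unitalQuantaleType dQ) d X
    of SupLattice d X := {
  act : Q -> X -> X;
  actM : forall (a b : Q) (x : X), act (a * b) x = act a (act b x);
  act1 : forall x : X, act 1 x = x;
  actr_preserves_joins : forall a : Q, preserves_joins (act a);
  actl_preserves_joins : forall x : X, preserves_joins (fun a : Q => act a x)
}.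

#[short(type="leftModuleType")]
HB.structure Definition LeftModule dQ (Q : unitalQuantaleType dQ) d :=
  { X of SupLattice d X & isLeftModule dQ Q d X }.

Notation "a *> x" := (act a x) (at level 40, left associativity) : group_scope.

(* The base locale; its joins are those of Q, so B is treated as a subset. *)
Definition base dQ (Q : unitalQuantaleType dQ) : set Q :=
  [set b : Q | b <= 1]%classic.

(* The carrier stands for the frame O(X) of the locale X. *)
HB.mixin Record isQLocale dQ (Q : unitalQuantaleType dQ) d X
    of Frame d X & LeftModule dQ Q d X := {
  base_act : forall (b : Q) (x : X), base b -> b *> x = (b *> \top) `&` x
}.

#[short(type="qLocaleType")]
HB.structure Definition QLocale dQ (Q : unitalQuantaleType dQ) d :=
  { X of Frame d X & LeftModule dQ Q d X & isQLocale dQ Q d X }.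

Section Sheaves.
Context dQ (Q : unitalQuantaleType dQ) d (X : qLocaleType Q d).

(* A homomorphism of B-modules O(X) -> B, seen as a Q-valued map. *)
Record base_hom (sg : X -> Q) : Prop := BaseHom {
  base_hom_base : forall x, base (sg x);
  base_hom_joins : preserves_joins sg;
  base_hom_act : forall b x, base b -> sg (b *> x) = b * sg x
}.

Definition open_support (sg : X -> Q) : Prop :=
  base_hom sg /\ forall x, sg x *> x = x.

Definition local_section (sg : X -> Q) : set X :=
  [set s : X | forall x, x <= s -> x = sg x *> s]%classic.

Definition is_sheaf : Prop :=
  exists2 sg : X -> Q, open_support sg & bigjoin (local_section sg) = \top.

End Sheaves.

Section HilbertModules.
Context dQ (Q : unitalInvolutiveQuantaleType dQ) d (X : leftModuleType Q d).
Variable ip : X -> X -> Q.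

Record is_inner_product : Prop := IsInnerProduct {
  ip_act : forall a x y, ip (a *> x) y = a * ip x y;
  ip_joins : forall y, preserves_joins (fun x => ip x y);
  ip_sym : forall x y, ip x y = (ip y x)^*
}.

Definition is_Hilbert : Prop :=
  is_inner_product /\ forall x y, (forall z, ip x z = ip y z) -> x = y.

Definition Hilbert_section : set X :=
  [set s : X | forall x, ip x s *> s <= x]%classic.

Definition is_complete_Hilbert : Prop :=
  is_Hilbert /\
  forall x, x = bigjoin [set ip x s *> s | s in Hilbert_section]%classic.

End HilbertModules.

(* Main.v *)
Require Import Defs.
From mathcomp Require Import all_boot all_order.
From mathcomp Require Import classical_sets.

Set Implicit Arguments.
Unset Strict Implicit.
Unset Printing Implicit Defensive.

Import Order.LTheory.

(** Think of Q as the topology of an etale groupoid G acting on X, where X is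
    fibred over the unit space of G by a local homeomorphism. The inner product
    of two open sets x and y is then the set of all arrows g that carry some
    point of y to a point of x. Partial units u are the local bisections of G,
    and an arrow g of u belongs to that set exactly when its target is below a
    point of x `&` u y. Hence the formula
      <x, y> = \join_u sg (x `&` u y) u,   u ranging over the partial units,
    where sg is the support of X ([sheaf_ip]).

    Since B consists of self-adjoint elements, everything reduces to one
    inequality, u sg(x) <= sg(u x) u for a partial unit u ([mul_sg_le]), which
    lets supports be moved across partial units. It gives <x, y>^* <= <y, x>
    term by term, hence symmetry; it gives u <x, y> <= <u x, y>, and applying
    this to u^* as well gives equality. As the partial units cover Q and Q is a
    frame, every element of Q is a join of partial units, so the inner product
    is Q-linear ([sheaf_ip_act]).

    The adjoint form of the same inequality shows that partial units map local
    sections to local sections ([local_section_act]). So for a local section s,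
    the element sg (x `&` u s) u s is just x `&` u s, whence <x, s> s <= x:
    local sections are Hilbert sections. Finally x is the join of the elements
    x `&` s = sg (x `&` s) s <= <x, s> s with s a local section, because local
    sections cover X. This is completeness, and it implies nondegeneracy: x is
    determined by the values <x, s>. *)

(** * Joins and join-preserving maps *)

Section BigJoin.
Local Open Scope order_scope.
Context d (T : supLatticeType d).
Implicit Types (x y m : T) (A : set T).

Lemma bigjoin_ub A x : A x -> x <= bigjoin A.
Proof. by have [ub _] := bigjoin_isLub A; apply: ub. Qed.

Lemma bigjoin_le A m : (forall x, A x -> x <= m) -> bigjoin A <= m.
Proof. by have [_ lub] := bigjoin_isLub A; apply: lub. Qed.

End BigJoin.

Section PreservesJoins.
Local Open Scope order_scope.
Context d (T : supLatticeType d).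
Implicit Types (x y : T) (A : set T).

Lemma preserves_joins_homo d' (U : supLatticeType d') (f : T -> U) :
  preserves_joins f -> {homo f : x y / x <= y}.
Proof.
move=> fJ x y le_xy.
have -> : y = bigjoin [set x; y]%classic.
  apply/le_anti; rewrite bigjoin_ub /=; last by right.
  by apply: bigjoin_le => z [] ->.
by rewrite fJ; apply: bigjoin_ub; exists x => //; left.
Qed.

Lemma preserves_joins_image d' (U : supLatticeType d') (f : T -> U)
    I (P : set I) (g : I -> T) : preserves_joins f ->
  f (bigjoin [set g i | i in P]%classic) =
  bigjoin [set f (g i) | i in P]%classic.
Proof. by move=> fJ; rewrite fJ image_comp. Qed.

Lemma preserves_joins_comp d' (U : supLatticeType d') d''
    (V : supLatticeType d'') (g : U -> V) (f : T -> U) :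
  preserves_joins g -> preserves_joins f -> preserves_joins (g \o f).
Proof. by move=> gJ fJ A; rewrite /= fJ gJ image_comp. Qed.

Lemma preserves_joins_bigjoin d' (U : supLatticeType d') I (P : set I)
    (f : I -> T -> U) : (forall i, preserves_joins (f i)) ->
  preserves_joins (fun x => bigjoin [set f i x | i in P]%classic).
Proof.
move=> fJ A; apply/le_anti/andP; split; apply: bigjoin_le => z [].
  move=> i Pi <-; rewrite fJ; apply: bigjoin_le => _ [x Ax <-].
  apply: (@le_trans _ _ (bigjoin [set f i x | i in P]%classic)).
    by apply: bigjoin_ub; exists i.
  by apply: bigjoin_ub; exists x.
move=> x Ax <-; apply: bigjoin_le => _ [i Pi <-].
apply: (@le_trans _ _ (f i (bigjoin A))).
  by apply: preserves_joins_homo => //; apply: bigjoin_ub.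
by apply: bigjoin_ub; exists i.
Qed.

End PreservesJoins.

Lemma meet_bigjoin d (X : frameType d) (y : X) :
  preserves_joins (fun x : X => Order.meet x y).
Proof.
move=> A; rewrite meetC meet_preserves_joins; congr bigjoin.
by apply: eq_imagel => x _; rewrite meetC.
Qed.

(** * Partial units of a quantal frame *)

Section PartialUnits.
Local Open Scope order_scope.
Local Open Scope group_scope.
Context dQ (Q : stableQuantalFrameType dQ).
Implicit Types a b c u v : Q.

Definition partial_unit : set Q :=
  [set s : Q | (s * s^* `|` s^* * s <= 1)%O]%classic.

Lemma mul_le a b c e : a <= b -> c <= e -> a * c <= b * e.
Proof.
move=> le_ab le_ce; apply: (@le_trans _ _ (b * c)).
  exact: (preserves_joins_homo (@mull_preserves_joins _ _ c)).
exact: (preserves_joins_homo (@mulr_preserves_joins _ _ b)).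
Qed.

Lemma star_le a b : a <= b -> a^* <= b^*.
Proof. exact: (preserves_joins_homo (@star_preserves_joins _ _)). Qed.

(** The support of a absorbs a and lies below a a^*. For a partial unit u it
    follows that u = u u^* u, as in an inverse semigroup. *)
Lemma le_mulstarmul a : a <= a * a^* * a.
Proof. exact: le_trans (le_supp_mul a) (mul_le (supp_le_mulstar a) (lexx a)). Qed.

Lemma base_le_star b : b <= 1 -> b <= b^*.
Proof.
move=> b1; apply: le_trans (le_mulstarmul b) _.
by rewrite -[leRHS]mul1g -[leRHS]mulg1 !mul_le.
Qed.

Lemma base_star b : b <= 1 -> b^* = b.
Proof.
move=> b1; apply/le_anti; rewrite base_le_star // andbT.
by rewrite -[leRHS]invgK base_le_star // -invg1 star_le.
Qed.

(** If c too lies in the base, this says b <= c `&` b, as multiplication in the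
    base is meet. *)
Lemma base_le_mul b c : b <= 1 -> b <= c -> b <= c * b.
Proof.
move=> b1 le_bc; apply: le_trans (le_mulstarmul b) _.
by rewrite base_star // -[c]mulg1 !mul_le.
Qed.

Lemma partial_unitP u :
  partial_unit u <-> u * u^* <= 1 /\ u^* * u <= 1.
Proof. by rewrite /partial_unit /= leUx; split=> [/andP|[-> ->]]. Qed.

Lemma partial_unit1 : partial_unit 1.
Proof. by apply/partial_unitP; rewrite invg1 mulg1. Qed.

Lemma partial_unit_star u : partial_unit u -> partial_unit u^*.
Proof. by case/partial_unitP => ? ?; apply/partial_unitP; rewrite invgK. Qed.

Lemma partial_unitM u v :
  partial_unit u -> partial_unit v -> partial_unit (u * v).
Proof.
case/partial_unitP => uu' u'u /partial_unitP [vv' v'v]; apply/partial_unitP.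
rewrite invgM; split.
  apply: (@le_trans _ _ (u * 1 * u^*)); last by rewrite mulg1.
  by rewrite mulgA -[u * v * _]mulgA !mul_le.
apply: (@le_trans _ _ (v^* * 1 * v)); last by rewrite mulg1.
by rewrite mulgA -[v^* * u^* * u]mulgA !mul_le.
Qed.

Lemma le_partial_unit u v : u <= v -> partial_unit v -> partial_unit u.
Proof.
move=> le_uv /partial_unitP [vv' v'v]; apply/partial_unitP; split.
  by apply: le_trans vv'; rewrite mul_le ?star_le.
by apply: le_trans v'v; rewrite mul_le ?star_le.
Qed.

End PartialUnits.

(** Elements below a partial unit are partial units, so by distributivity of the
    frame Q this exhibits every element as a join of partial units. *)
Lemma partial_units_cover dQ (Q : inverseQuantalFrameType dQ) (a : Q) :
  a = bigjoin [set Order.meet a u | u in @partial_unit _ Q]%classic.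
Proof.
by rewrite -meet_preserves_joins bigjoin_partial_units meetx1.
Qed.

(** * Moving supports across partial units *)

Section Supports.
Local Open Scope order_scope.
Local Open Scope group_scope.
Context dQ (Q : stableQuantalFrameType dQ) d (X : qLocaleType Q d).
Variable sg : X -> Q.
Hypothesis sg_open : open_support sg.
Implicit Types (u v b : Q) (x y z s : X).

Lemma act_le u v x y : u <= v -> x <= y -> u *> x <= v *> y.
Proof.
move=> le_uv le_xy; apply: (@le_trans _ _ (v *> x)).
  exact: (preserves_joins_homo (@actl_preserves_joins _ _ _ _ x)).
exact: (preserves_joins_homo (@actr_preserves_joins _ _ _ _ v)).
Qed.

Lemma sg_base x : sg x <= 1. Proof. exact: base_hom_base sg_open.1 x. Qed.

Lemma sg_le x y : x <= y -> sg x <= sg y.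
Proof. exact: (preserves_joins_homo (base_hom_joins sg_open.1)). Qed.

Lemma sgK x : sg x *> x = x. Proof. exact: sg_open.2. Qed.

Lemma sg_act b x : b <= 1 -> sg (b *> x) = b * sg x.
Proof. by move=> b1; rewrite (base_hom_act sg_open.1). Qed.

Lemma act_base_le b x : b <= 1 -> b *> x <= x.
Proof. by move=> b1; rewrite -{2}[x]act1 act_le. Qed.

Lemma act_starK u x : partial_unit u -> u^* *> (u *> x) <= x.
Proof. by case/partial_unitP => _ u'u; rewrite -actM act_base_le. Qed.

(** As u <= u u^* u, multiplying u x by u u^* does not shrink it, and u u^* lies
    in the base, so that it comes out of the support. *)
Lemma sg_act_le u x : partial_unit u -> sg (u *> x) <= u * u^*.
Proof.
case/partial_unitP => uu' _.
apply: (@le_trans _ _ (sg (u * u^* *> (u *> x)))).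
  by apply: sg_le; rewrite -actM act_le ?le_mulstarmul.
by rewrite sg_act // -[leRHS]mulg1 mul_le ?sg_base.
Qed.

(** The element e = u^* sg(u x) u of the base acts on x as u^* u does; comparing
    supports of e x gives u^* u sg(x) = e sg(x) <= e. Conjugating by u turns
    this into the claim. *)
Lemma conj_sg_le u x : partial_unit u -> u * sg x * u^* <= sg (u *> x).
Proof.
case/partial_unitP => uu' u'u; set c := sg (u *> x).
have c1 : c <= 1 by exact: sg_base.
have dom : u^* * u * sg x <= u^* * c * u.
  set e := u^* * c * u.
  have e1 : e <= 1.
    apply: le_trans u'u; apply: (@le_trans _ _ (u^* * 1 * u)).
      by rewrite !mul_le.
    by rewrite mulg1.
  have ex : e *> x = u^* * u *> x by rewrite /e -mulgA !actM sgK.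
  rewrite -sg_act // -ex sg_act //.
  by rewrite -[leRHS]mulg1 mul_le ?sg_base.
apply: (@le_trans _ _ (u * (u^* * c * u) * u^*)).
  apply: mul_le => //; apply: le_trans (mul_le (lexx u) dom).
  by rewrite !mulgA mul_le // le_mulstarmul.
apply: (@le_trans _ _ (1 * c * 1)); last by rewrite mul1g mulg1.
by rewrite !mulgA -[_ * u * u^*]mulgA !mul_le.
Qed.

(** The key inequality: a point of u sg(x) is an arrow of u whose source lies
    below x, and its target then lies below u x. Algebraically, for a = u sg(x),
    a <= a a^* a <= (u sg(x) u^* ) u. *)
Lemma mul_sg_le u x : partial_unit u -> u * sg x <= sg (u *> x) * u.
Proof.
move=> pu; apply: le_trans (mul_le (conj_sg_le x pu) (lexx u)).
apply: le_trans (le_mulstarmul _) _.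
rewrite invgM (base_star (sg_base x)) !mulgA.
apply: (@le_trans _ _ (u * sg x * 1 * u^* * u * 1)); last by rewrite !mulg1.
by rewrite !mul_le ?sg_base.
Qed.

Lemma sg_mul_le u x : partial_unit u -> sg x * u <= u * sg (u^* *> x).
Proof.
move=> pu; rewrite -[leLHS]invgK -[leRHS]invgK star_le // !invgM.
by rewrite !(base_star (sg_base _)) mul_sg_le //; apply: partial_unit_star.
Qed.

(** If z <= u s then u^* z <= s, so u^* z = sg(u^* z) s; moving the support back
    through u compares sg(z) u s with u u^* z <= z. *)
Lemma local_section_act u s :
  partial_unit u -> local_section sg s -> local_section sg (u *> s).
Proof.
move=> pu ls z le_zus; have [uu' _] := (partial_unitP u).1 pu.
apply/le_anti/andP; split; first by rewrite -{1}[z]sgK act_le.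
have le_u'z : u^* *> z <= s.
  by apply: le_trans (act_starK s pu); rewrite act_le.
rewrite -actM; apply: le_trans (act_le (sg_mul_le z pu) (lexx s)) _.
by rewrite actM -ls // -actM act_base_le.
Qed.

(** * The inner product of a sheaf *)

Definition sheaf_ip x y : Q :=
  bigjoin [set sg (x `&` u *> y)%O * u | u in @partial_unit _ Q]%classic.

Lemma sheaf_ip_ub u x y :
  partial_unit u -> sg (x `&` u *> y)%O * u <= sheaf_ip x y.
Proof. by move=> pu; apply: bigjoin_ub; exists u. Qed.

Lemma sheaf_ip_joins y : preserves_joins (fun x => sheaf_ip x y).
Proof.
apply: (@preserves_joins_bigjoin _ X _ Q _ _
  (fun u x => sg (x `&` u *> y)%O * u)) => u.
apply: (preserves_joins_comp (@mull_preserves_joins _ _ u)).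
apply: (preserves_joins_comp (base_hom_joins sg_open.1)).
exact: meet_bigjoin.
Qed.

Lemma sheaf_ip_star_le x y : (sheaf_ip x y)^* <= sheaf_ip y x.
Proof.
rewrite /sheaf_ip (preserves_joins_image _ _ (@star_preserves_joins _ Q)).
apply: bigjoin_le => _ [u pu <-]; have pu' := partial_unit_star pu.
rewrite invgM (base_star (sg_base _)).
apply: le_trans (mul_sg_le _ pu') _; apply: le_trans (sheaf_ip_ub y x pu').
rewrite mul_le // sg_le // lexI; apply/andP; split.
  by apply: le_trans (act_starK y pu); rewrite act_le ?leIr.
by rewrite act_le ?leIl.
Qed.

Lemma sheaf_ip_sym x y : sheaf_ip x y = (sheaf_ip y x)^*.
Proof.
apply/le_anti; rewrite sheaf_ip_star_le andbT.
by rewrite -[leLHS]invgK star_le ?sheaf_ip_star_le.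
Qed.

Lemma mul_sheaf_ip_le u x y :
  partial_unit u -> u * sheaf_ip x y <= sheaf_ip (u *> x) y.
Proof.
move=> pu; rewrite /sheaf_ip (preserves_joins_image _ _ (mulr_preserves_joins u)).
apply: bigjoin_le => _ [v pv <-]; rewrite mulgA.
apply: le_trans (mul_le (mul_sg_le _ pu) (lexx v)) _; rewrite -mulgA.
apply: le_trans (sheaf_ip_ub _ _ (partial_unitM pu pv)).
rewrite mul_le // sg_le // lexI actM; apply/andP.
by split; rewrite act_le ?leIl ?leIr.
Qed.

(** Every arrow of <u x, y> has its target in u u^*, so that
    <u x, y> <= u u^* <u x, y> <= u <u^* u x, y> <= u <x, y>. *)
Lemma sheaf_ip_act_partial_unit u x y :
  partial_unit u -> sheaf_ip (u *> x) y = u * sheaf_ip x y.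
Proof.
move=> pu; apply/le_anti; rewrite mul_sheaf_ip_le // andbT.
apply: (@le_trans _ _ (u * u^* * sheaf_ip (u *> x) y)).
  apply: bigjoin_le => _ [v pv <-].
  apply: (@le_trans _ _ (u * u^* * (sg (u *> x `&` v *> y)%O * v))).
    rewrite mulgA mul_le // base_le_mul ?sg_base //.
    by apply: le_trans (sg_act_le x pu); rewrite sg_le ?leIl.
  by rewrite mul_le ?sheaf_ip_ub.
rewrite -mulgA mul_le //.
apply: le_trans (mul_sheaf_ip_le _ _ (partial_unit_star pu)) _.
apply: (preserves_joins_homo (sheaf_ip_joins y)).
exact: act_starK.
Qed.

(** For a local section s each u s is again one, so that the term of <x, s> s at
    u is x `&` u s itself. *)
Lemma local_section_Hilbert s : local_section sg s -> Hilbert_section sheaf_ip s.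
Proof.
move=> ls x; rewrite /sheaf_ip.
rewrite (preserves_joins_image _ _ (@actl_preserves_joins _ _ _ _ s)).
apply: bigjoin_le => _ [u pu <-].
by rewrite actM -(local_section_act pu ls) ?leIl ?leIr.
Qed.

Lemma sheaf_ip_complete x :
  bigjoin (local_section sg) = \top ->
  x = bigjoin [set sheaf_ip x s *> s | s in Hilbert_section sheaf_ip]%classic.
Proof.
move=> cover; apply/le_anti/andP; split; last first.
  by apply: bigjoin_le => _ [s Hs <-]; apply: Hs.
rewrite -{1}[x]meetx1 -cover meet_preserves_joins.
apply: bigjoin_le => _ [s ls <-].
apply: (@le_trans _ _ (sheaf_ip x s *> s)); last first.
  by apply: bigjoin_ub; exists s => //; apply: local_section_Hilbert.
(* The partial unit u = 1 already contributes enough to <x, s>. *)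
rewrite [leLHS](ls _ (leIr _ _)) act_le //.
by have := sheaf_ip_ub x s (partial_unit1 Q); rewrite act1 mulg1.
Qed.

End Supports.

Lemma sheaf_ip_act dQ (Q : inverseQuantalFrameType dQ) d (X : qLocaleType Q d)
    (sg : X -> Q) (sg_open : open_support sg) (a : Q) (x y : X) :
  sheaf_ip sg (act a x) y = mul a (sheaf_ip sg x y).
Proof.
pose P := [set Order.meet a u | u in @partial_unit _ Q]%classic.
have PJ (b : Q) : P b -> partial_unit b.
  by case=> u pu <-; apply: le_partial_unit pu; apply: leIr.
rewrite (partial_units_cover a) -/P actl_preserves_joins mull_preserves_joins.
rewrite (preserves_joins_image _ _ (sheaf_ip_joins sg_open y)).
congr bigjoin; apply: eq_imagel => b Pb.
exact: sheaf_ip_act_partial_unit (PJ b Pb).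
Qed.

Theorem theorem4p55 (dQ : Order.disp_t) (Q : inverseQuantalFrameType dQ)
  (d : Order.disp_t) (X : qLocaleType Q d) :
  is_sheaf X -> exists ip : X -> X -> Q, is_complete_Hilbert ip.
Proof.
case=> sg sg_open cover; exists (sheaf_ip sg).
have complete x := sheaf_ip_complete sg_open x cover.
split=> //; split; first split.
- exact: sheaf_ip_act.
- exact: sheaf_ip_joins.
- exact: sheaf_ip_sym.
move=> x y eq_xy; rewrite (complete x) (complete y).
by congr bigjoin; apply: eq_imagel => s _; rewrite eq_xy.
Qed.
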